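(* Let $U_{h,+}^n$ and $U_{h,-}^n$ be generated from the same real initial data $U_h(0)$ by the two conjugate choices $a_+$ and $a_-$, $a_\pm=\frac14\pm\frac{\mathrm i}{4\sqrt3}$, i.e. $U_{h,\pm}^{n}=\Phi_{\Delta t}(a_\pm)^nU_h(0)$, and let $U_h(t)$ be the exact solution of the semidiscrete Maxwell system with the same initial data, $t_n=n\Delta t$. Then $$U_{h,-}^n=\overline{U_{h,+}^n},\qquad \widehat U_h^n:=\operatorname{Re}U_{h,+}^n=\frac12\left(U_{h,+}^n+U_{h,-}^n\right).$$ Thus $\widehat U_h^n$ is real and independent of the selected conjugate branch. Moreover, $$\left\|\widehat U_h^n-U_h(t_n)\right\|_h\le\left\|U_{h,+}^n-U_h(t_n)\right\|_h .$$ Consequently $\widehat U_h^n$ retains at least second-order convergence on the fixed grid: if all nonzero Fourier modes satisfy $0\le q\le q_0<\sqrt{12}$, then for every fixed $T>0$ there is a constant $C_{h,T,q_0}$ independent of $\Delta t$ with $$\max_{0\le n\Delta t\le T}\left\|\widehat U_h^n-U_h(t_n)\right\|_h\le C_{h,T,q_0}\,\Delta t^2\,\|U_h(0)\|_h .$$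
   Context: Continuous system. With constant $\varepsilon,\mu>0$, $\nu=(\varepsilon\mu)^{-1/2}$, $\bm h=\sqrt\mu\,\bm H$, $\bm e=\sqrt\varepsilon\,\bm E$, the source-free Maxwell equations in energy-scaled variables are $\partial_t\bm h=-\nu\nabla\times\bm e$, $\partial_t\bm e=\nu\nabla\times\bm h$, with periodic boundary conditions. Spatial discretization. The fields depend on $d\in\{1,2,3\}$ active coordinates and are sampled on a fixed periodic uniform Yee-type staggered grid with equal mesh width $\Delta x$ in the active directions ($e_i$ is located at half-integer points in direction $i$ and integer points in the other directions; $h_i$ at integer points in direction $i$ and half-integer points in the other directions). Each partial derivative in an active direction is replaced by $\frac{27(u_{i+1/2}-u_{i-1/2})-(u_{i+3/2}-u_{i-3/2})}{24\Delta x}$ (derivatives in inactive directions are zero). Replacing both curls by the resulting discrete curls gives the finite-dimensional semidiscrete Maxwell system $\frac{d}{dt}U_h=(\mathcal C_h+\mathcal D_h)U_h$ for $U_h=(\bm h,\bm e)$, with real matrices $$\mathcal C_h=\nu\begin{bmatrix}0&0\\ \nabla_h\times&0\end{bmatrix},\qquad \mathcal D_h=\nu\begin{bmatrix}0&-\nabla_h\times\\0&0\end{bmatrix}.$$ The norm $\|\cdot\|_h$ is the complex discrete $\ell^2$ norm (square root of $\Delta x^d$ times the sum of squared moduli of all components); $\operatorname{Re}$ and the bar act componentwise. Time stepping. For $a\in\mathbb{C}$, $$\Phi_{\Delta t}(a)=e^{a\Delta t\mathcal C_h}e^{\frac12\Delta t\mathcal D_h}e^{(1-2a)\Delta t\mathcal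 C_h}e^{\frac12\Delta t\mathcal D_h}e^{a\Delta t\mathcal C_h},$$ where $e^{\tau\mathcal C_h}=I+\tau\mathcal C_h$ and $e^{\tau\mathcal D_h}=I+\tau\mathcal D_h$. Fourier modes. For a discrete wave vector $\kappa$ of the grid, $\eta_\xi=\frac{27\sin(\kappa_\xi\Delta x/2)-\sin(3\kappa_\xi\Delta x/2)}{12}$, $K_h^2=\frac1{\Delta x^2}\sum_{\xi=1}^d\eta_\xi^2$, and $q=\nu\Delta tK_h$. The constant $C_{h,T,q_0}$ may depend on the fixed grid, $T$, $q_0$ and $\nu$, but not on $\Delta t$ nor on the initial data. *)

(* Defs.v *)
From HB Require Import structures.
From mathcomp Require Import all_boot all_order all_algebra.
From mathcomp Require Import complex.
From mathcomp Require Import all_classical all_reals all_analysis.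

Set Implicit Arguments.
Unset Strict Implicit.
Unset Printing Implicit Defensive.

Import Order.TTheory GRing.Theory Num.Theory.
Import numFieldNormedType.Exports.

Local Open Scope ring_scope.
Local Open Scope complex_scope.

Section StaggeredGrid.

(* [A] is the set of active coordinates, so that the space dimension is
   d = #|A|; [N xi] is the number of cells in the active direction xi. *)
Variables (A : {set 'I_3}) (N : 'I_3 -> nat).

(* Positions are measured in half cells: the coordinate [p xi] stands for the
   physical coordinate [p xi * dx / 2], modulo the period [N xi * dx].  Even
   coordinates are the integer points, odd ones the half-integer points.
   Fields do not depend on an inactive coordinate, which has a single value. *)
Definition period (xi : 'I_3) : nat := if xi \in A then (N xi).*2 else 1%N.

Definition position : finType := {dffun forall xi : 'I_3, 'I_(period xi)}.

(* A degree of freedom (i, p) is the component i of a field sampled at p. *)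
Definition edofs : {set 'I_3 * position} :=
  [set x : 'I_3 * position | [forall xi in A, odd (x.2 xi) == (xi == x.1)]]%SET.

Definition hdofs : {set 'I_3 * position} :=
  [set x : 'I_3 * position | [forall xi in A, odd (x.2 xi) == (xi != x.1)]]%SET.

(* [p'] is [p] moved forward by [k] half cells in direction [xi]; "[p'] is [p]
   moved backward" is [ahead xi k p' p]. *)
Definition ahead (xi : 'I_3) (k : nat) (p p' : position) : bool :=
  (p' xi == p xi + k %[mod period xi])%N &&
  [forall zeta, (zeta != xi) ==> (p' zeta == p zeta)].

Variables (R : realType) (dx nu : R).

(* Weight of the sample at [p'] in the difference quotient at [p].  On very
   coarse grids several of the four points coincide modulo the period; their
   weights are then added. *)
Definition diff_weight (xi : 'I_3) (p p' : position) : R :=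
  if xi \in A then
    (27%:R * ((ahead xi 1 p p')%:R - (ahead xi 1 p' p)%:R)
      - ((ahead xi 3 p p')%:R - (ahead xi 3 p' p)%:R)) / (24%:R * dx)
  else 0.

(* (curl u)_i = D_(i+1) u_(i+2) - D_(i+2) u_(i+1); additions on 'I_3 are
   modulo 3. *)
Definition curl_weight (x y : 'I_3 * position) : R :=
  (y.1 == x.1 + 2%:R)%:R * diff_weight (x.1 + 1) x.2 y.2
  - (y.1 == x.1 + 1)%:R * diff_weight (x.1 + 2%:R) x.2 y.2.

Definition curl_of_h : 'M[R]_(#|edofs|, #|hdofs|) :=
  \matrix_(r, c) curl_weight (enum_val r) (enum_val c).

Definition curl_of_e : 'M[R]_(#|hdofs|, #|edofs|) :=
  \matrix_(r, c) curl_weight (enum_val r) (enum_val c).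

Definition ndofs : nat := (#|hdofs| + #|edofs|)%N.

Definition Cmx : 'M[R]_ndofs := nu *: block_mx 0 0 curl_of_h 0.

Definition Dmx : 'M[R]_ndofs := nu *: block_mx 0 (- curl_of_e) 0 0.

(* C and D have square zero, so the exponential series of tau C and tau D stop
   after two terms: [expC] and [expD] below are the matrix exponentials. *)
Lemma Cmx_sqr0 : Cmx *m Cmx = 0.
Proof.
rewrite /Cmx -scalemxAl -scalemxAr mulmx_block.
by rewrite !(mul0mx, mulmx0, addr0) block_mx0 !scaler0.
Qed.

Lemma Dmx_sqr0 : Dmx *m Dmx = 0.
Proof.
rewrite /Dmx -scalemxAl -scalemxAr mulmx_block.
by rewrite !(mul0mx, mulmx0, addr0) block_mx0 !scaler0.
Qed.

Definition exact_solution (U0 : 'cV[R]_ndofs) (U : R -> 'cV[R]_ndofs) : Prop :=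
  U 0 = U0 /\ forall t : R, is_derive t 1 U ((Cmx + Dmx) *m U t).

Definition toC (m n : nat) (M : 'M[R]_(m, n)) : 'M[R[i]]_(m, n) :=
  map_mx (real_complex R) M.

Definition conj_field (m n : nat) (M : 'M[R[i]]_(m, n)) : 'M[R[i]]_(m, n) :=
  map_mx conjc M.

Definition re_field (m n : nat) (M : 'M[R[i]]_(m, n)) : 'M[R[i]]_(m, n) :=
  map_mx (fun z => (complex.Re z)%:C) M.

Definition expC (tau : R[i]) : 'M[R[i]]_ndofs := 1%:M + tau *: toC Cmx.

Definition expD (tau : R[i]) : 'M[R[i]]_ndofs := 1%:M + tau *: toC Dmx.

Definition Phi (dt : R) (a : R[i]) : 'M[R[i]]_ndofs :=
  expC (a * dt%:C) *m expD (2%:R^-1 * dt%:C)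
  *m expC ((1 - 2%:R * a) * dt%:C)
  *m expD (2%:R^-1 * dt%:C) *m expC (a * dt%:C).

Definition iterate (dt : R) (a : R[i]) (U0 : 'cV[R]_ndofs) (n : nat) :
    'cV[R[i]]_ndofs := Phi dt a ^+ n *m toC U0.

Definition hnorm (u : 'cV[R[i]]_ndofs) : R :=
  Num.sqrt (dx ^+ #|A| * \sum_k ComplexField.Normc.normc (u k 0) ^+ 2).

(* Discrete wave vectors kappa_xi = 2 pi m_xi / (N_xi dx), where 0 <= m_xi < N_xi
   runs over the active coordinates. *)
Definition wave_index (m : 'I_3 -> nat) : Prop :=
  forall xi, xi \in A -> (m xi < N xi)%N.

Definition nonzero_wave_index (m : 'I_3 -> nat) : Prop :=
  exists2 xi, xi \in A & m xi != 0%N.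

Definition kappa (m : 'I_3 -> nat) (xi : 'I_3) : R :=
  2%:R * pi * (m xi)%:R / ((N xi)%:R * dx).

Definition eta (m : 'I_3 -> nat) (xi : 'I_3) : R :=
  (27%:R * sin (kappa m xi * dx / 2%:R) - sin (3%:R * kappa m xi * dx / 2%:R))
    / 12%:R.

Definition Kh (m : 'I_3 -> nat) : R :=
  Num.sqrt ((dx ^+ 2)^-1 * \sum_(xi in A) eta m xi ^+ 2).

Definition courant (dt : R) (m : 'I_3 -> nat) : R := nu * dt * Kh m.

End StaggeredGrid.

Definition a_plus (R : realType) : R[i] :=
  4%:R^-1 +i* (4%:R * Num.sqrt 3%:R)^-1.

Definition a_minus (R : realType) : R[i] :=
  4%:R^-1 -i* (4%:R * Num.sqrt 3%:R)^-1.

(* Main.v *)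
(** The two branches are conjugate because C and D are real, and taking real
    parts is a contraction towards real vectors, so the rate of [Uhat] is that
    of [Uplus].  Since C and D square to zero, the coefficients of CD and DC in
    the product defining Phi are both 1/2, so Phi agrees with
    1 + dt M + dt^2 M^2 / 2, M = C + D, up to O(dt^3).  Whenever 1 <= n and
    n dt <= T one has dt <= T, so all these O-constants are uniform and
    |Phi| <= 1 + L dt; the local errors then accumulate to
    n (1 + L dt)^n O(dt^3) <= T exp (L T) O(dt^2).  All estimates are made in
    the entrywise l^1 norm, which is equivalent to the discrete l^2 norm on the
    fixed grid. *)

Require Import Defs.
From HB Require Import structures.
From mathcomp Require Import all_boot all_order all_algebra.
From mathcomp Require Import complex.
From mathcomp Require Import all_classical all_reals all_analysis.
From mathcomp Require Import ring lra.

Set Implicit Arguments.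
Unset Strict Implicit.
Unset Printing Implicit Defensive.

Import Order.TTheory GRing.Theory Num.Theory.
Import numFieldNormedType.Exports.

Local Open Scope ring_scope.
Local Open Scope complex_scope.

(** * Entrywise l^1 norm of complex matrices *)

Section MatrixNorm.
Context {R : realType}.
Import ComplexField.Normc.

Lemma normc_ge0 (z : R[i]) : 0 <= normc z.
Proof. by case: z => x y; exact: sqrtr_ge0. Qed.

Lemma normc_real (x : R) : normc x%:C = `|x|.
Proof. by rewrite /= expr0n addr0 sqrtr_sqr. Qed.

Lemma normc_sum (I : finType) (F : I -> R[i]) :
  normc (\sum_i F i) <= \sum_i normc (F i).
Proof.
elim/big_rec2: _ => [|i x y _ IH]; first by rewrite normc0.
exact: le_trans (le_normcD _ _) (lerD _ IH).
Qed.

(** One submultiplicative norm for all shapes, serving operators and fields alike; the identity of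
    size [n] has norm [n], not 1. *)
Definition mnorm m n (M : 'M[R[i]]_(m, n)) : R := \sum_i \sum_j normc (M i j).

Lemma mnorm_ge0 m n (M : 'M[R[i]]_(m, n)) : 0 <= mnorm M.
Proof. by do 2![apply: sumr_ge0 => ? _]; exact: normc_ge0. Qed.

Lemma mnormD m n (M P : 'M[R[i]]_(m, n)) : mnorm (M + P) <= mnorm M + mnorm P.
Proof.
rewrite -big_split ler_sum// => i _; rewrite -big_split ler_sum// => j _.
by rewrite mxE; exact: le_normcD.
Qed.

Lemma mnormZ m n (a : R[i]) (M : 'M[R[i]]_(m, n)) :
  mnorm (a *: M) = normc a * mnorm M.
Proof.
rewrite /mnorm mulr_sumr; apply: eq_bigr => i _.
by rewrite mulr_sumr; apply: eq_bigr => j _; rewrite mxE normcM.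
Qed.

Lemma mnorm0 m n : mnorm (0 : 'M[R[i]]_(m, n)) = 0.
Proof. by rewrite -[0 in LHS](scale0r 0) mnormZ normc0 mul0r. Qed.

(** Expanding the product of the norms pairs every column of [M] with every row of [P]; the matrix
    product uses only the diagonal pairs, and the others are nonnegative. *)
Lemma mnorm_mul m n p (M : 'M[R[i]]_(m, n)) (P : 'M[R[i]]_(n, p)) :
  mnorm (M *m P) <= mnorm M * mnorm P.
Proof.
rewrite /mnorm mulr_suml ler_sum// => i _.
apply: (@le_trans _ _ (\sum_j \sum_k normc (M i k) * normc (P k j))).
  apply: ler_sum => j _; rewrite mxE; apply: le_trans (normc_sum _) _.
  by apply: ler_sum => k _; rewrite normcM.
rewrite exchange_big mulr_suml ler_sum//= => k _.
rewrite -mulr_sumr ler_wpM2l ?normc_ge0//.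
rewrite [leRHS](bigD1 k)//= lerDl.
by do 2![apply: sumr_ge0 => ? _]; exact: normc_ge0.
Qed.

Lemma mnorm_toC m n (M : 'M[R]_(m, n)) :
  mnorm (toC M) = \sum_i \sum_j `|M i j|.
Proof.
by do 2![apply: eq_bigr => ? _]; rewrite mxE normc_real.
Qed.

Lemma le_entry_mnorm m n (M : 'M[R]_(m, n)) i j : `|M i j| <= mnorm (toC M).
Proof.
rewrite mnorm_toC (bigD1 i)//= (bigD1 j)//= -addrA lerDl addr_ge0//.
  by apply: sumr_ge0 => ? _.
by do 2![apply: sumr_ge0 => ? _].
Qed.

End MatrixNorm.

(** * Second-order expansions in the time step, and the splitting *)

Section Jets.
Context {R : realType}.
Import ComplexField.Normc.

(** Taylor expansion at 0 with a remainder uniform on [0, T]. [F2] is the coefficient of t^2 itself,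
    so it carries any factor 1/2. *)
Definition jet2 (T : R) n (F : R -> 'M[R[i]]_n) (F0 F1 F2 : 'M[R[i]]_n) :=
  exists2 K : R, 0 <= K & forall t : R, 0 <= t -> t <= T ->
    mnorm (F t - (F0 + t%:C *: F1 + t%:C ^+ 2 *: F2)) <= K * t ^+ 3.

Lemma jet2_mul (T : R) n (F : R -> 'M[R[i]]_n) (F0 F1 F2 Z : 'M[R[i]]_n) :
  jet2 T F F0 F1 F2 ->
  jet2 T (fun t => F t *m (1%:M + t%:C *: Z))
    F0 (F1 + F0 *m Z) (F2 + F1 *m Z).
Proof.
move=> [K K0 FK].
(* For negative [T] no time is admissible; the witness for the other case needs [T] nonnegative. *)
have [T0|T0] := ltP T 0.
  by exists 0 => // t t0 /(le_trans t0)/(lt_le_trans T0); rewrite ltxx.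
exists (K * (mnorm (1%:M : 'M[R[i]]_n) + T * mnorm Z) + mnorm (F2 *m Z)).
  by rewrite addr_ge0 ?mulr_ge0 ?addr_ge0 ?mulr_ge0 ?mnorm_ge0.
move=> t t0 tT; pose P := F0 + t%:C *: F1 + t%:C ^+ 2 *: F2.
(* The old remainder times the new factor, plus the only term of degree three that the product of
   the polynomials creates. *)
have -> : F t *m (1%:M + t%:C *: Z) -
    (F0 + t%:C *: (F1 + F0 *m Z) + t%:C ^+ 2 *: (F2 + F1 *m Z)) =
    (F t - P) *m (1%:M + t%:C *: Z) + t%:C ^+ 3 *: (F2 *m Z).
  rewrite mulmxBl opprD; rewrite -[RHS]addrA; congr (_ + _).
  rewrite /P !mulmxDr !mulmx1 !mulmxDl -!scalemxAr -!scalemxAl !scalerDr !scalerA.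
  move: (F0 *m Z) (F1 *m Z) (F2 *m Z) => A B C.
  by apply/matrixP => i j; rewrite !mxE; ring.
apply: le_trans (mnormD _ _) _; rewrite mnormZ mulrDl; apply: lerD; last first.
  by rewrite -rmorphXn normc_real ger0_norm ?exprn_ge0// mulrC.
apply: le_trans (mnorm_mul _ _) _.
rewrite mulrAC ler_pM ?mnorm_ge0 ?FK//.
apply: le_trans (mnormD _ _) _.
by rewrite lerD2l mnormZ normc_real ger0_norm// ler_wpM2r ?mnorm_ge0.
Qed.

Lemma eq_jet2 (T : R) n (F G : R -> 'M[R[i]]_n)
    (F0 F1 F2 G0 G1 G2 : 'M[R[i]]_n) :
  jet2 T F F0 F1 F2 -> F =1 G -> F0 = G0 -> F1 = G1 -> F2 = G2 ->
  jet2 T G G0 G1 G2.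
Proof. by move=> FJ /funext <- <- <- <-. Qed.

Lemma jet2_1 (T : R) n : jet2 T (fun=> 1%:M) (1%:M : 'M[R[i]]_n) 0 0.
Proof.
exists 0 => // t _ _.
by rewrite !scaler0 !addr0 subrr mnorm0 mul0r.
Qed.

(** The jet is built one factor at a time. The coefficient of [X *m Y] is a/2 + (1 - 2a)/2 + a/2 =
    1/2, and by symmetry of the composition so is that of [Y *m X], for every [a]; the squares of
    [X] and [Y] vanish. *)
Lemma jet2_splitting (T : R) n (X Y : 'M[R[i]]_n) (a : R[i]) :
  X *m X = 0 -> Y *m Y = 0 ->
  jet2 T (fun t => (1%:M + (a * t%:C) *: X) *m (1%:M + (2%:R^-1 * t%:C) *: Y)
    *m (1%:M + ((1 - 2%:R * a) * t%:C) *: X)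
    *m (1%:M + (2%:R^-1 * t%:C) *: Y) *m (1%:M + (a * t%:C) *: X))
   1%:M (X + Y) (2%:R^-1 *: ((X + Y) *m (X + Y))).
Proof.
move=> X2 Y2.
have := jet2_1 T n.
move=> /(@jet2_mul _ _ _ _ _ _ (a *: X)) /(@jet2_mul _ _ _ _ _ _ (2%:R^-1 *: Y)).
move=> /(@jet2_mul _ _ _ _ _ _ ((1 - 2%:R * a) *: X)).
move=> /(@jet2_mul _ _ _ _ _ _ (2%:R^-1 *: Y)) /(@jet2_mul _ _ _ _ _ _ (a *: X)).
have h2 : (2%:R : R[i]) != 0 by rewrite pnatr_eq0.
move=> J; apply: (eq_jet2 J) => //.
- by move=> t; rewrite !scalerA ![t%:C * _]mulrC mul1mx.
- by rewrite !mul1mx add0r; apply/matrixP => i j; rewrite !mxE; field.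
- rewrite !mul1mx mul0mx !add0r.
  rewrite !mulmxDl !mulmxDr -?scalemxAl -?scalemxAr ?scalerA X2 Y2 !scaler0.
  move: (X *m Y) (Y *m X) => A B.
  by apply/matrixP => i j; rewrite !mxE; field.
Qed.

End Jets.

(** * Growth and Taylor expansion of the exact linear flow *)

Section LinearODE.
Context {R : realType}.

Lemma is_derive_continuous (f df : R -> R) :
  (forall t : R, is_derive t 1 f (df t)) -> continuous f.
Proof.
move=> fd t; apply: differentiable_continuous.
exact/derivable1_diffP/ex_derive.
Qed.

(** The mean value theorem replaces integration, giving the constant [c] instead of c/(k+1). *)
Lemma ler_deriv_pow (f df : R -> R) (t0 t1 c : R) (k : nat) :
  0 <= c -> f t0 = 0 -> (forall t : R, is_derive t 1 f (df t)) ->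
  (forall t, t0 <= t -> t <= t1 -> `|df t| <= c * (t - t0) ^+ k) ->
  forall t, t0 <= t -> t <= t1 -> `|f t| <= c * (t - t0) ^+ k.+1.
Proof.
move=> c0 f0 fd le_df t t0t tt1.
have [|x + ] := @MVT_segment R f df t0 t t0t (fun x _ => fd x).
  by apply: continuous_subspaceT; exact: is_derive_continuous fd.
rewrite in_itv/= f0 subr0 => /andP[t0x xt] ->.
rewrite normrM (ger0_norm (_ : 0 <= t - t0)) ?subr_ge0// exprSr mulrA.
rewrite ler_wpM2r ?subr_ge0//.
apply: le_trans (le_df x t0x (le_trans xt tt1)) _.
by rewrite ler_wpM2l// lerXn2r ?nnegrE ?subr_ge0// lerD2r.
Qed.

(** [ler_deriv_pow] is applied in turn to the Taylor remainders of [f2], [f1] and [f], each being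
    the derivative of the next; hence [c] rather than c/6. *)
Lemma taylor2_bound (f f1 f2 f3 : R -> R) (t0 t1 c : R) :
  0 <= c -> t0 <= t1 -> (forall t : R, is_derive t 1 f (f1 t)) ->
  (forall t : R, is_derive t 1 f1 (f2 t)) -> (forall t : R, is_derive t 1 f2 (f3 t)) ->
  (forall t, t0 <= t -> t <= t1 -> `|f3 t| <= c) ->
  `|f t1 - (f t0 + (t1 - t0) * f1 t0 + (t1 - t0) ^+ 2 * (2%:R^-1 * f2 t0))|
    <= c * (t1 - t0) ^+ 3.
Proof.
move=> c0 t01 d1 d2 d3 bd3.
have b2 := @ler_deriv_pow (fun t => f2 t - f2 t0) f3 t0 t1 c 0 c0.
have {}b2 t : t0 <= t -> t <= t1 -> `|f2 t - f2 t0| <= c * (t - t0) ^+ 1.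
  apply: b2; rewrite ?subrr// => {}t; last by rewrite mulr1; exact: bd3.
  by apply: is_derive_eq; rewrite subr0.
have b1 t : t0 <= t -> t <= t1 ->
    `|f1 t - (f1 t0 + (t - t0) * f2 t0)| <= c * (t - t0) ^+ 2.
  move: t; apply: (@ler_deriv_pow _ (fun t => f2 t - f2 t0)) => // [|t].
    by rewrite subrr mul0r addr0 subrr.
  by apply: is_derive_eq; rewrite /GRing.scale/=; ring.
have b0 t : t0 <= t -> t <= t1 ->
    `|f t - (f t0 + (t - t0) * f1 t0 + (t - t0) ^+ 2 * (2%:R^-1 * f2 t0))|
      <= c * (t - t0) ^+ 3.
  move: t; apply: (@ler_deriv_pow _ (fun t => f1 t - (f1 t0 + (t - t0) * f2 t0))) => // [|t].
    by rewrite subrr expr2 !mul0r !addr0 subrr.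
  by apply: is_derive_eq; rewrite /GRing.scale/=; field.
exact: b0.
Qed.

(** The general [A] allows the entries of U, M U and M^2 U to be differentiated in turn. *)
Lemma is_derive_mxrow m n (A : 'M[R]_(m, n)) (U : R -> 'cV[R]_n)
    (dU : 'cV[R]_n) (t : R) (k : 'I_m) :
  is_derive t 1 U dU ->
  is_derive t 1 (fun t => (A *m U t) k 0) ((A *m dU) k 0).
Proof.
move=> Ud.
have Uj j : is_derive t 1 (fun t => U t j 0) (dU j 0).
  have /derivable_mxP Ux : derivable U t 1 by exact: ex_derive.
  apply: DeriveDef; first exact: Ux.
  by rewrite -(@derive_val _ _ _ _ _ _ _ Ud) derive_mx ?mxE.
rewrite mxE (_ : (fun _ => _) = \sum_j A k j \*: (fun t => U t j 0)).
  exact: is_derive_sum.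
by apply/funext => s; rewrite mxE fct_sumE.
Qed.

(** Each |u_k| |u_j| is at most the sum of squares, since (|u_k| - |u_j|)^2 is nonnegative; the
    weights |M_kj| add up to the norm of [M]. *)
Lemma le_quadratic_form n (M : 'M[R]_n) (u : 'cV[R]_n) :
  \sum_k u k 0 * (M *m u) k 0 <= mnorm (toC M) * \sum_k u k 0 ^+ 2.
Proof.
rewrite mnorm_toC mulr_suml; apply: ler_sum => k _.
rewrite mxE mulr_sumr mulr_suml; apply: ler_sum => j _.
rewrite mulrCA; apply: le_trans (ler_norm _) _; rewrite normrM ler_wpM2l//.
have sq_le i : u i 0 ^+ 2 <= \sum_k u k 0 ^+ 2.
  by rewrite (bigD1 i)//= lerDl sumr_ge0// => ? _; exact: sqr_ge0.
have := sq_le k; have := sq_le j; rewrite normrM -(real_normK (num_real (u k 0))).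
rewrite -(real_normK (num_real (u j 0))).
have := sqr_ge0 (`|u k 0| - `|u j 0|).
by move: `|u k 0| `|u j 0| (\sum_k _) => x y s; nra.
Qed.

(* Gronwall for the energy: [expR (- 2 L t) * |U t|^2] is nonincreasing. *)
Lemma linear_ode_energy n (M : 'M[R]_n) (U : R -> 'cV[R]_n) (t : R) :
  (forall t : R, is_derive t 1 U (M *m U t)) -> 0 <= t ->
  \sum_k U t k 0 ^+ 2 <=
    expR (mnorm (toC M) * t) ^+ 2 * \sum_k U 0 k 0 ^+ 2.
Proof.
move=> Ud t0; set L := mnorm _.
have Uk k (s : R) : is_derive s 1 (fun s => U s k 0) ((M *m U s) k 0).
  have := is_derive_mxrow 1%:M k (Ud s); rewrite mul1mx.
  by under eq_fun do rewrite mul1mx.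
pose E := \sum_k (fun s => U s k 0) ^+ 2.
have EE s : E s = \sum_k U s k 0 ^+ 2.
  by rewrite /E fct_sumE; apply: eq_bigr => k _; rewrite exprfctE.
pose g s := expR (- (2%:R * L) * s) * E s.
have gd (s : R) : is_derive s 1 g (expR (- (2%:R * L) * s) *
    (2%:R * (\sum_k U s k 0 * (M *m U s) k 0 - L * E s))).
  have Ed : is_derive s 1 E (2%:R * \sum_k U s k 0 * (M *m U s) k 0).
    rewrite mulr_sumr; under eq_bigr do rewrite mulrA.
    by rewrite /E; apply: is_derive_sum => k; apply: is_deriveX.
  by apply: is_derive_eq; rewrite /GRing.scale/=; ring.
have [|s _] := @MVT_segment R g _ 0 t t0 (fun x _ => gd x).
  by apply: continuous_subspaceT; exact: is_derive_continuous gd.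
rewrite subr0 => gE.
have : g t <= g 0.
  rewrite -subr_le0 gE mulr_le0_ge0// mulr_ge0_le0 ?expR_ge0//.
  by rewrite mulr_ge0_le0// subr_le0 EE; exact: le_quadratic_form.
rewrite /g mulr0 expR0 mul1r -!EE -expRM_natl => le_g.
have -> : E t = expR (2%:R * (L * t)) * (expR (- (2%:R * L) * t) * E t).
  by rewrite mulrA -expRD mulrA -mulrDl subrr mul0r expR0 mul1r.
by rewrite ler_wpM2l ?expR_ge0.
Qed.

(** Each entry is at most the root of the energy, and the initial energy is at most the squared l^1
    norm; the factor [n] counts the entries. *)
Lemma linear_ode_bound n (M : 'M[R]_n) (U : R -> 'cV[R]_n) (t : R) :
  (forall t : R, is_derive t 1 U (M *m U t)) -> 0 <= t ->
  mnorm (toC (U t)) <= n%:R * (expR (mnorm (toC M) * t) * mnorm (toC (U 0))).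
Proof.
move=> Ud t0; rewrite mulr_natl -[X in _ *+ X](card_ord n) -sumr_const.
rewrite [leLHS]mnorm_toC; apply: ler_sum => k _; rewrite big_ord1.
rewrite -[leRHS]ger0_norm ?mulr_ge0 ?mnorm_ge0 ?expR_ge0//.
rewrite -ler_sqr ?nnegrE// !real_normK ?num_real// exprMn.
apply: (@le_trans _ _ (\sum_k U t k 0 ^+ 2)).
  by rewrite (bigD1 k)//= lerDl sumr_ge0// => ? _; exact: sqr_ge0.
apply: le_trans (linear_ode_energy Ud t0) _.
rewrite ler_wpM2l ?exprn_ge0 ?expR_ge0// expr2 {1}mnorm_toC mulr_suml.
apply: ler_sum => j _; rewrite big_ord1 -real_normK ?num_real// expr2.
by rewrite ler_wpM2l// le_entry_mnorm.
Qed.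

(** The derivatives of [U] are M U, M^2 U and M^3 U, so scalar Taylor applies to each entry, with
    third derivative at most |M|^3 c. *)
Lemma linear_ode_taylor n (M : 'M[R]_n) (U : R -> 'cV[R]_n) (t0 t1 c : R) :
  (forall t : R, is_derive t 1 U (M *m U t)) -> t0 <= t1 ->
  (forall t, t0 <= t -> t <= t1 -> mnorm (toC (U t)) <= c) ->
  mnorm (toC (U t1) - (1%:M + (t1 - t0)%:C *: toC M + (t1 - t0)%:C ^+ 2 *:
     (2%:R^-1 *: (toC M *m toC M))) *m toC (U t0))
  <= n%:R * (mnorm (toC M) ^+ 3 * c * (t1 - t0) ^+ 3).
Proof.
move=> Ud t01 Uc.
have dA (A : 'M[R]_n) k (s : R) :
    is_derive s 1 (fun t => (A *m U t) k 0) ((A *m M *m U s) k 0).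
  by rewrite -mulmxA; exact: is_derive_mxrow.
set h := t1 - t0.
(* The expression is the embedding of a real one; the factors [1%:M] keep every term in the form
   that [dA] differentiates. *)
have -> : toC (U t1) - (1%:M + h%:C *: toC M + h%:C ^+ 2 *:
     (2%:R^-1 *: (toC M *m toC M))) *m toC (U t0) =
    toC (1%:M *m U t1 - (1%:M *m U t0 + h *: (1%:M *m M *m U t0)
      + h ^+ 2 *: (2%:R^-1 *: (1%:M *m M *m M *m U t0)))).
  rewrite !mul1mx !mulmxDl -!scalemxAl mul1mx /toC map_mxB !map_mxD !map_mxZ.
  by rewrite !map_mxM rmorphXn fmorphV rmorph_nat.
set B := mnorm _ ^+ 3 * _ * _.
rewrite mulr_natl -[X in B *+ X](card_ord n) -sumr_const mnorm_toC.
have c0 : 0 <= c by apply: le_trans (Uc t0 (lexx _) t01); exact: mnorm_ge0.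
apply: ler_sum => k _; rewrite big_ord1 !mxE.
have := @taylor2_bound _ _ _ _ t0 t1 (mnorm (toC M) ^+ 3 * c) _ t01
  (dA 1%:M k) (dA (1%:M *m M) k) (dA (1%:M *m M *m M) k).
rewrite -/h !mxE; apply.
  by rewrite mulr_ge0 ?exprn_ge0 ?mnorm_ge0.
move=> t tt0 tt1; apply: le_trans (le_entry_mnorm _ _ _) _.
rewrite mul1mx /toC !map_mxM; apply: le_trans (mnorm_mul _ _) _.
rewrite ler_pM ?mnorm_ge0 ?Uc//; apply: le_trans (mnorm_mul _ _) _.
by rewrite exprSr ler_wpM2r ?mnorm_ge0// expr2 mnorm_mul.
Qed.

End LinearODE.

(** * From stability and local errors to the global error *)

Section Convergence.
Context {R : realType}.
Import ComplexField.Normc.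

(** One step propagates the previous error, multiplied by at most [b], and adds one local error
    [d]. *)
Lemma iterate_error n (P : 'M[R[i]]_n) (V : nat -> 'cV[R[i]]_n) (b d : R) (m : nat) :
  1 <= b -> 0 <= d -> (forall v : 'cV_n, mnorm (P *m v) <= b * mnorm v) ->
  (forall j, (j < m)%N -> mnorm (P *m V j - V j.+1) <= d) ->
  mnorm (P ^+ m *m V 0%N - V m) <= m%:R * (b ^+ m * d).
Proof.
move=> b1 d0 Pb; elim: m => [|m IH] Vd.
  by rewrite expr0 mul1mx subrr mul0r mnorm0.
have {}IH := IH (fun j jm => Vd j (ltnW jm)).
have -> : P ^+ m.+1 *m V 0%N - V m.+1 =
    P *m (P ^+ m *m V 0%N - V m) + (P *m V m - V m.+1).
  by rewrite exprS -mulmxE mulmxBr mulmxA addrA subrK.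
apply: le_trans (mnormD _ _) _.
(* The new local error is not amplified; [1 <= b] lets it fit under the common factor b^(m+1). *)
rewrite -natr1 mulrDl mul1r lerD//; last first.
  apply: le_trans (Vd m (ltnSn m)) _.
  by rewrite ler_peMl// exprn_ege1.
apply: le_trans (Pb _) _; rewrite exprS -mulrA mulrCA ler_wpM2l//.
exact: le_trans b1.
Qed.

Lemma jet2_lipschitz (T : R) n (F : R -> 'M[R[i]]_n) (F1 F2 : 'M[R[i]]_n) :
  jet2 T F 1%:M F1 F2 ->
  exists2 L : R, 0 <= L & forall t, 0 <= t -> t <= T ->
    forall v : 'cV_n, mnorm (F t *m v) <= (1 + L * t) * mnorm v.
Proof.
(* From t^2 <= |T| t and t^3 <= |T|^2 t; the absolute values keep the constant nonnegative for every
   sign of [T]. *)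
move=> [K K0 FK]; exists (mnorm F1 + `|T| * mnorm F2 + K * `|T| ^+ 2).
  by rewrite !addr_ge0 ?mulr_ge0 ?mnorm_ge0.
move=> t t0 tT v.
have tT' : t <= `|T| by rewrite (le_trans tT) ?ler_norm.
(* The identity is split off before taking norms: its l^1 norm is [n], which would ruin stability
   under iteration. *)
have -> : F t = 1%:M + ((F t - (1%:M + t%:C *: F1 + t%:C ^+ 2 *: F2))
     + (t%:C *: F1 + t%:C ^+ 2 *: F2)).
  by apply/matrixP => i j; rewrite !mxE; ring.
rewrite mulmxDl mul1mx.
apply: le_trans (mnormD _ _) _; rewrite mulrDl mul1r lerD2l.
apply: le_trans (mnorm_mul _ _) _; rewrite ler_wpM2r ?mnorm_ge0//.
rewrite [leRHS]mulrDl [leRHS]addrC.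
apply: le_trans (mnormD _ _) _; apply: lerD.
  apply: le_trans (FK t t0 tT) _.
  by rewrite exprSr mulrA ler_wpM2r// ler_wpM2l// lerXn2r ?nnegrE.
apply: le_trans (mnormD _ _) _.
rewrite !mnormZ -rmorphXn !normc_real !ger0_norm ?exprn_ge0// ?(le_trans t0)//.
rewrite mulrDl [t * _]mulrC lerD2l expr2 -mulrA [leRHS]mulrC ler_wpM2l//.
by rewrite ler_wpM2r ?mnorm_ge0.
Qed.

Lemma jet2_convergence (T : R) n (M : 'M[R]_n) (F : R -> 'M[R[i]]_n) :
  jet2 T F 1%:M (toC M) (2%:R^-1 *: (toC M *m toC M)) ->
  exists2 K : R, 0 <= K & forall (dt : R) (U : R -> 'cV[R]_n), 0 < dt ->
    (forall t : R, is_derive t 1 U (M *m U t)) ->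
    forall m : nat, m%:R * dt <= T ->
    mnorm (F dt ^+ m *m toC (U 0) - toC (U (m%:R * dt)))
      <= K * dt ^+ 2 * mnorm (toC (U 0)).
Proof.
move=> FJ; have [L L0 FL] := jet2_lipschitz FJ; case: FJ => K K0 FK.
(* Growth factor of the exact flow on [0, T]. *)
pose c := n%:R * expR (mnorm (toC M) * T).
have c0 : 0 <= c by rewrite mulr_ge0 ?expR_ge0.
(* Local error constant: the remainder of [F] plus the Taylor remainder of the exact flow. *)
pose k := K * c + n%:R * (mnorm (toC M) ^+ 3 * c).
have k0 : 0 <= k by rewrite addr_ge0 ?mulr_ge0 ?exprn_ge0 ?mnorm_ge0.
exists (`|T| * (expR (L * T) * k)).
  by rewrite !mulr_ge0 ?expR_ge0.
(* At step 0 the error vanishes; only from step 1 on does the time constraint give [dt <= T]. *)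
move=> dt U dt0 Ud [|m].
  rewrite mul0r expr0 mul1mx subrr mnorm0 => _.
  by rewrite !mulr_ge0 ?expR_ge0 ?exprn_ge0 ?mnorm_ge0 ?(ltW dt0).
move=> mT; have T0 : 0 <= T by apply: le_trans mT; rewrite mulr_ge0 ?(ltW dt0).
have dtT : dt <= T by apply: le_trans mT; rewrite ler_peMl ?(ltW dt0)// ler1n.
have Uc t : 0 <= t -> t <= T -> mnorm (toC (U t)) <= c * mnorm (toC (U 0)).
  move=> t0 tT; apply: le_trans (linear_ode_bound Ud t0) _.
  rewrite /c -mulrA ler_wpM2l// ler_wpM2r ?mnorm_ge0// ler_expR.
  by rewrite ler_wpM2l ?mnorm_ge0.
pose d := k * dt ^+ 3 * mnorm (toC (U 0)).
have d0 : 0 <= d by rewrite !mulr_ge0 ?exprn_ge0 ?mnorm_ge0 ?(ltW dt0).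
have b1 : 1 <= 1 + L * dt by rewrite lerDl mulr_ge0 ?(ltW dt0).
have := @iterate_error _ (F dt) (fun j => toC (U (j%:R * dt))) _ _ m.+1 b1 d0
  (FL dt (ltW dt0) dtT).
rewrite mul0r => /(_ _)/le_trans; apply => [j jm|].
  have jT : j.+1%:R * dt <= T.
    by apply: le_trans mT; rewrite ler_wpM2r ?(ltW dt0)// ler_nat.
  have j0 : 0 <= j%:R * dt by rewrite mulr_ge0 ?(ltW dt0).
  have jE : j.+1%:R * dt - j%:R * dt = dt by rewrite -natr1; ring.
  have jj : j%:R * dt <= j.+1%:R * dt by rewrite -subr_ge0 jE ltW.
  set P := 1%:M + dt%:C *: toC M + dt%:C ^+ 2 *: (2%:R^-1 *: (toC M *m toC M)).
  (* The Taylor polynomial [P], shared by the scheme and the exact flow, is inserted between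
     them. *)
  have -> : F dt *m toC (U (j%:R * dt)) - toC (U (j.+1%:R * dt)) =
      (F dt - P) *m toC (U (j%:R * dt))
      + (- 1) *: (toC (U (j.+1%:R * dt)) - P *m toC (U (j%:R * dt))).
    by rewrite mulmxBl scaleN1r opprB addrA subrK.
  apply: le_trans (mnormD _ _) _; rewrite mnormZ normcN normc1 mul1r.
  rewrite /d /k !mulrDl; apply: lerD.
    apply: le_trans (mnorm_mul _ _) _.
    rewrite -mulrA mulrACA mulrA -mulrA.
    rewrite ler_pM ?mnorm_ge0 ?FK ?(ltW dt0)// Uc// (le_trans jj)//.
  have := @linear_ode_taylor _ _ _ _ _ _ (c * mnorm (toC (U 0))) Ud jj _.
  rewrite jE => /(_ _)/le_trans; apply => [t jt tj|].
    by apply: Uc; [exact: le_trans jt|exact: le_trans jT].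
  by rewrite le_eqVlt; apply/orP; left; apply/eqP; ring.
rewrite /d.
(* One of the three powers of [dt] joins the number of steps to form a time at most [T], leaving
   dt^2. *)
have -> : m.+1%:R * ((1 + L * dt) ^+ m.+1 * (k * dt ^+ 3 * mnorm (toC (U 0)))) =
   (m.+1%:R * dt) * ((1 + L * dt) ^+ m.+1 * k) * dt ^+ 2 * mnorm (toC (U 0)).
  ring.
rewrite ler_wpM2r ?mnorm_ge0// ler_wpM2r ?exprn_ge0 ?(ltW dt0)//.
have bm : 0 <= (1 + L * dt) ^+ m.+1 by rewrite exprn_ge0// (le_trans _ b1).
apply: ler_pM; rewrite ?mulr_ge0 ?(ltW dt0)//.
  by rewrite (le_trans mT)// ler_norm.
rewrite ler_wpM2r//.
(* 1 + x <= exp x turns the accumulated amplification into the exponential of L (m+1) dt, at most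
   exp (L T). *)
apply: (@le_trans _ _ (expR (L * dt) ^+ m.+1)).
  by rewrite lerXn2r ?nnegrE ?expR_ge0 ?expR_ge1Dx// (le_trans _ b1).
by rewrite -expRM_natl ler_expR mulrCA ler_wpM2l.
Qed.

End Convergence.

(** * Discrete fields: norm equivalence, real parts and conjugation *)

Section Fields.
Context {R : realType} {A : {set 'I_3}} {N : 'I_3 -> nat}.
Import ComplexField.Normc.
Implicit Types u : 'cV[R[i]]_(ndofs A N).

(** A sum of squares is at most the square of the sum. The grid weight is kept as a factor so that
    it cancels against the one in [mnorm_le_hnorm]. *)
Lemma hnorm_le_mnorm (dx : R) u : 0 <= dx ->
  hnorm dx u <= Num.sqrt (dx ^+ #|A|) * mnorm u.
Proof.
move=> dx0; rewrite /hnorm sqrtrM ?exprn_ge0// ler_wpM2l ?sqrtr_ge0//.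
have m0 : 0 <= mnorm u := mnorm_ge0 u.
rewrite -(ler_sqr (sqrtr_ge0 _))// sqr_sqrtr; last first.
  by apply: sumr_ge0 => ? _; exact: sqr_ge0.
have E : mnorm u = \sum_k normc (u k 0) by apply: eq_bigr => k _; rewrite big_ord1.
rewrite expr2 {1}E mulr_suml; apply: ler_sum => k _.
rewrite expr2 ler_wpM2l ?normc_ge0// E (bigD1 k)//= lerDl.
by apply: sumr_ge0 => ? _; exact: normc_ge0.
Qed.

Lemma mnorm_le_hnorm (dx : R) u : 0 <= dx ->
  Num.sqrt (dx ^+ #|A|) * mnorm u <= (ndofs A N)%:R * hnorm dx u.
Proof.
move=> dx0; rewrite /hnorm sqrtrM ?exprn_ge0// mulrCA ler_wpM2l ?sqrtr_ge0//.
rewrite mulr_natl -[X in _ *+ X]card_ord -sumr_const.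
apply: ler_sum => k _; rewrite big_ord1 -[leLHS]ger0_norm ?normc_ge0//.
rewrite -sqrtr_sqr ler_wsqrtr// (bigD1 k)//= lerDl.
by apply: sumr_ge0 => ? _; exact: sqr_ge0.
Qed.

(** As [v] is real, the left side only drops the imaginary part of each entry of the difference. *)
Lemma hnorm_re_field (dx : R) u (v : 'cV[R]_(ndofs A N)) : 0 <= dx ->
  hnorm dx (re_field u - toC v) <= hnorm dx (u - toC v).
Proof.
move=> dx0; rewrite /hnorm ler_wsqrtr// ler_wpM2l ?exprn_ge0//.
apply: ler_sum => k _; rewrite lerXn2r ?nnegrE ?normc_ge0// !mxE.
case: (u k 0) => x y /=; rewrite ler_wsqrtr// lerD2l.
by rewrite oppr0 addr0 expr0n sqr_ge0.
Qed.

Lemma conj_field_mul m n p (M : 'M[R[i]]_(m, n)) (P : 'M[R[i]]_(n, p)) :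
  conj_field (M *m P) = conj_field M *m conj_field P.
Proof. exact: map_mxM. Qed.

Lemma conj_field_toC m n (M : 'M[R]_(m, n)) : conj_field (toC M) = toC M.
Proof. by apply/matrixP => i j; rewrite !mxE conjc_real. Qed.

Lemma conj_field_shift n (a : R[i]) (M : 'M[R]_n) :
  conj_field (1%:M + a *: toC M) = 1%:M + conjc a *: toC M.
Proof. by rewrite /conj_field map_mxD map_mx1 map_mxZ -/(conj_field _) conj_field_toC. Qed.

(** Every factor is the identity plus a scalar times a real matrix, and [dt] and 1/2 are real, so
    conjugation acts on [a] alone. *)
Lemma conj_field_Phi (dx nu dt : R) (a : R[i]) :
  conj_field (Phi A N dx nu dt a) = Phi A N dx nu dt (conjc a).
Proof.
have conj_dt b : conjc (b * dt%:C) = conjc b * dt%:C.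
  by rewrite rmorphM; congr (_ * _); exact: conjc_real.
have conj_half : conjc (2%:R^-1 : R[i]) = 2%:R^-1 by rewrite conjc_inv conjc_nat.
have conj_mid : conjc (1 - 2%:R * a) = 1 - 2%:R * conjc a.
  by rewrite rmorphB rmorph1 rmorphM rmorph_nat.
by rewrite /Phi !conj_field_mul !conj_field_shift !conj_dt conj_half conj_mid.
Qed.

Lemma conj_field_iterate (dx nu dt : R) (a : R[i]) (U0 : 'cV[R]_(ndofs A N)) n :
  conj_field (iterate dx nu dt a U0 n) = iterate dx nu dt (conjc a) U0 n.
Proof.
rewrite /iterate conj_field_mul conj_field_toC; congr (_ *m _).
elim: n => [|n IH]; first by rewrite !expr0 /conj_field map_mx1.
by rewrite !exprS -!mulmxE conj_field_mul conj_field_Phi IH.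
Qed.

Lemma re_field_half_sum m n (M : 'M[R[i]]_(m, n)) :
  re_field M = 2%:R^-1 *: (M + conj_field M).
Proof.
apply/matrixP => i j; rewrite !mxE; case: (M i j) => x y.
have -> : x +i* y + (x +i* y)^* = 2%:R * x%:C.
  by apply/eqP; rewrite mulr_natl mulr2n eq_complex /= subrr addr0 !eqxx.
by rewrite mulKf ?pnatr_eq0.
Qed.

Lemma re_field_conj m n (M : 'M[R[i]]_(m, n)) :
  re_field (conj_field M) = re_field M.
Proof. by apply/matrixP => i j; rewrite !mxE; case: (M i j). Qed.

Lemma iterate_convergence (dx nu T : R) (a : R[i]) : 0 < dx ->
  exists K : R, forall (dt : R) (U0 : 'cV[R]_(ndofs A N))
    (U : R -> 'cV[R]_(ndofs A N)), 0 < dt -> exact_solution dx nu U0 U ->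
    forall n : nat, n%:R * dt <= T ->
      hnorm dx (iterate dx nu dt a U0 n - toC (U (n%:R * dt)))
        <= K * dt ^+ 2 * hnorm dx (toC U0).
Proof.
move=> dx0.
have := @jet2_splitting _ T _ (toC (Cmx A N dx nu)) (toC (Dmx A N dx nu)) a.
have toC_sqr0 (M : 'M[R]_(ndofs A N)) : M *m M = 0 -> toC M *m toC M = 0.
  by rewrite /toC -map_mxM => ->; rewrite map_mx0.
move=> /(_ (toC_sqr0 _ (Cmx_sqr0 _ _ _ _)) (toC_sqr0 _ (Dmx_sqr0 _ _ _ _))).
have <- : toC (Cmx A N dx nu + Dmx A N dx nu) = toC (Cmx A N dx nu) + toC (Dmx A N dx nu).
  exact: map_mxD.
move=> /jet2_convergence[K K0 conv].
(* The number of unknowns is the cost of bounding the l^1 norm of the initial data by its l^2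
   norm. *)
exists (K * (ndofs A N)%:R) => dt U0 U dt0 [<- Ud] n nT.
apply: le_trans (hnorm_le_mnorm _ (ltW dx0)) _.
apply: (@le_trans _ _ (Num.sqrt (dx ^+ #|A|) * (K * dt ^+ 2 * mnorm (toC (U 0))))).
  by rewrite ler_wpM2l ?sqrtr_ge0//; exact: conv.
rewrite mulrCA [K * _%:R * _]mulrAC -[leRHS]mulrA ler_wpM2l ?mulr_ge0 ?(ltW dt0)//.
exact: mnorm_le_hnorm (ltW dx0).
Qed.

End Fields.

Theorem corollary3p7 (R : realType) (A : {set 'I_3}) (N : 'I_3 -> nat)
    (dx nu : R)
    (hA : (0 < #|A|)%N)
    (hN : forall xi, xi \in A -> (0 < N xi)%N)
    (hdx : 0 < dx)
    (hnu : exists eps mu : R,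
       [/\ 0 < eps, 0 < mu & nu = (Num.sqrt (eps * mu))^-1]) :
  let Uplus (dt : R) (U0 : 'cV[R]_(ndofs A N)) (n : nat) :=
    iterate dx nu dt (a_plus R) U0 n in
  let Uminus (dt : R) (U0 : 'cV[R]_(ndofs A N)) (n : nat) :=
    iterate dx nu dt (a_minus R) U0 n in
  let Uhat (dt : R) (U0 : 'cV[R]_(ndofs A N)) (n : nat) :=
    re_field (Uplus dt U0 n) in
  [/\ forall (dt : R) (U0 : 'cV[R]_(ndofs A N)) (n : nat), 0 < dt ->
        [/\ Uminus dt U0 n = conj_field (Uplus dt U0 n),
            Uhat dt U0 n = 2%:R^-1 *: (Uplus dt U0 n + Uminus dt U0 n),
            Uhat dt U0 n \is a mxOver Num.real
          & Uhat dt U0 n = re_field (Uminus dt U0 n)],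
      forall (dt : R) (U0 : 'cV[R]_(ndofs A N)) (U : R -> 'cV[R]_(ndofs A N))
          (n : nat), 0 < dt ->
        exact_solution dx nu U0 U ->
        hnorm dx (Uhat dt U0 n - toC (U (n%:R * dt)))
          <= hnorm dx (Uplus dt U0 n - toC (U (n%:R * dt)))
    & forall q0 T : R, q0 < Num.sqrt 12%:R -> 0 < T ->
        exists K : R,
        forall (dt : R) (U0 : 'cV[R]_(ndofs A N))
            (U : R -> 'cV[R]_(ndofs A N)),
          0 < dt ->
          exact_solution dx nu U0 U ->
          (forall m, wave_index A N m -> nonzero_wave_index A m ->
             0 <= courant A N dx nu dt m <= q0) ->
          forall n : nat, n%:R * dt <= T ->
            hnorm dx (Uhat dt U0 n - toC (U (n%:R * dt)))
              <= K * dt ^+ 2 * hnorm dx (toC U0)].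
Proof.
move=> Uplus Uminus Uhat.
(* [a_minus] is [conjc] of [a_plus] by computation. *)
have conjU dt U0 n : Uminus dt U0 n = conj_field (Uplus dt U0 n).
  by rewrite conj_field_iterate.
split.
- move=> dt U0 n _; split.
  + exact: conjU.
  + by rewrite conjU -re_field_half_sum.
  + by apply/mxOverP => k j; rewrite mxE complex_real.
  + by rewrite conjU re_field_conj.
- by move=> dt U0 U n _ _; exact: hnorm_re_field (ltW hdx).
- move=> q0 T _ _.
  have [K conv] := @iterate_convergence R A N dx nu T (a_plus R) hdx.
  exists K => dt U0 U dt0 Usol _ n nT.
  exact: le_trans (hnorm_re_field _ _ (ltW hdx)) (conv _ _ _ dt0 Usol _ nT).
Qed.
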